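(* Let $X=(\mathbf{R}/\mathbf{Z})^n$ be the $n$-dimensional torus and $I=(0,1)$. Let $u=u(x,t)$ be a $C^2$ function on $X\times I$ (with $u(\cdot,t)$ viewed as a $\mathbf{Z}^n$-periodic function on $\mathbf{R}^n$) satisfying the strict convexity condition that the matrix $\left(\frac{\partial^2u}{\partial x_j\partial x_k}+\delta_{jk}\right)_{1\le j,k\le n}$ is positive definite at every point of $X\times I$. Let $(x,t)\to(y,s)$ be the change of variables $y_j=\frac{\partial u}{\partial x_j}(x,t)+x_j$, $s=t$, and let $f=f(y,s)$ be the partial Legendre transform of $u$, i.e. $f(y,s)=-\frac12|x-y|^2-u(x,s)$ with $x=x(y,s)$ determined by $y_j=\frac{\partial u}{\partial x_j}(x,s)+x_j$. (a) If $F(D^2u)=0$ is a second-order elliptic PDE for $u$, then it can also be viewed as a second-order elliptic PDE for $f$. Precisely: let $F$ be a $C^1$ function of the second derivatives $(u_{tt},u_{tx_j},u_{x_jx_k})$ such that $F(D^2u)=0$ is elliptic at $u$. For $q\in\mathbf{R}$, $p\in\mathbf{R}^n$ and a real symmetric $n\times n$ matrix $H$ with $H+I$ positive definite, let $(h^{jk})=(H+I)^{-1}$ and let $\tilde F(q,p,H)$ be the value of $F$ at $$u_{tt}=-q+\sum_{j,k}h^{jk}p_jp_k,\qquad u_{tx_j}=-\sum_k h^{kj}p_k,\qquad u_{x_jx_k}=h^{jk}-\delta_{jk}.$$ Then, at points corresponding under $(x,t)\to(y,s)$, $F(D^2u)=\tilde F(f_{ss},(f_{sy_j})_j,(f_{y_jy_k})_{j,k})$,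 so that $F(D^2u)=0$ is equivalent to the second-order equation $\tilde F(f_{ss},(f_{sy_j})_j,(f_{y_jy_k})_{j,k})=0$ for $f$, and this equation is elliptic at $f$. (b) In particular, given a function $K$, $u$ satisfies the Monge-Ampère equation $$\det\left(D_{x,t}^2u+I_x\right)=K$$ on $X\times I$ if and only if its partial Legendre transform $f$ satisfies on $X\times I$ the equation $$\frac{\partial^2f}{\partial s^2}+K\,\det\left(D_y^2f+I\right)=0,$$ where $K$ is evaluated at points corresponding under $(x,t)\to(y,s)$.
   Context: For each $t\in I$, the map $x\mapsto y=\left(\frac{\partial u}{\partial x_k}(x,t)+x_k\right)_k$ is a bijection of $\mathbf{R}^n$ onto $\mathbf{R}^n$, which commutes with integer translations, so it descends to $X$; the function $f(\cdot,s)$ is $\mathbf{Z}^n$-periodic in $y$ and is regarded as a function on $X\times I$. $I$ also denotes the $n\times n$ identity matrix. $I_x$ is the $(n+1)\times(n+1)$ matrix, in the variables $(x,t)$, whose $x$-$x$ block is the $n\times n$ identity and whose other entries are $0$. $D^2_{x,t}u$ is the full $(n+1)\times(n+1)$ Hessian of $u$ in $(x,t)$ and $D_y^2f$ is the $n\times n$ Hessian of $f$ in $y$. Ellipticity: writing the linearization of $F(D^2u)$ as $\delta F=\frac{\partial F}{\partial u_{tt}}(\delta u)_{tt}+\sum_j\frac{\partial F}{\partial u_{tx_j}}(\delta u)_{tx_j}+\sum_{j,k}\frac{\partial F}{\partial u_{x_jx_k}}(\delta u)_{x_jx_k}$, the equation is elliptic at $u$ if at every point the quadratic form $\frac{\partial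 F}{\partial u_{tt}}\tau^2+\sum_j\frac{\partial F}{\partial u_{tx_j}}\tau\xi_j+\sum_{j,k}\frac{\partial F}{\partial u_{x_jx_k}}\xi_j\xi_k$ in $(\tau,\xi)\in\mathbf{R}\times\mathbf{R}^n$ is definite (positive definite, or negative definite, which amounts to replacing $F$ by $-F$). Ellipticity of the equation for $f$ at $f$ is defined in the same way, with $\tilde F$ and $(f_{ss},f_{sy_j},f_{y_jy_k})$ in place of $F$ and $(u_{tt},u_{tx_j},u_{x_jx_k})$. *)

(* Defs.v *)
From HB Require Import structures.
From mathcomp Require Export all_boot all_order all_algebra.
From mathcomp Require Export all_classical all_reals all_analysis.
Export numFieldNormedType.Exports.

Set Implicit Arguments.
Unset Strict Implicit.
Unset Printing Implicit Defensive.

Import Order.TTheory GRing.Theory Num.Theory.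

Local Open Scope classical_set_scope.
Local Open Scope ring_scope.

(* [C1_on] and [C2_on] are only used for finite-dimensional V and open A, where
   asking for every direction v is the same as asking for a basis. *)
Definition C1_on (R : realType) (V : normedModType R) (A : set V)
    (g : V -> R) : Prop :=
  forall p, A p -> differentiable g p /\ forall v, {for p, continuous ('D_v g)}.

Definition C2_on (R : realType) (V : normedModType R) (A : set V)
    (g : V -> R) : Prop :=
  C1_on A g /\ forall v, C1_on A ('D_v g).

Section PartialLegendre.
Variables (R : realType) (n : nat).

(* A function on X * I is a function on R^n * R, Z^n-periodic in the first
   variable, of which only the values on R^n * (0, 1) matter. *)
Local Notation E := ('rV[R]_n * R)%type.

Definition strip : set E := [set p | 0 < p.2 < 1].

Definition periodic (u : E -> R) : Prop :=
  forall (k : 'rV[int]_n) (x : 'rV[R]_n) (t : R), strip (x, t) ->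
    u (x + map_mx intr k, t) = u (x, t).

Definition C2_torus (u : E -> R) : Prop := periodic u /\ C2_on strip u.

Definition posdef (A : 'M[R]_n) : Prop :=
  A^T = A /\ forall v : 'rV[R]_n, v != 0 -> 0 < (v *m A *m v^T) 0 0.

Definition xdir (j : 'I_n) : E := (delta_mx 0 j, 0).
Definition tdir : E := (0, 1).

Definition grad_x (u : E -> R) (p : E) : 'rV[R]_n := \row_j 'D_(xdir j) u p.

Definition hess_x (u : E -> R) (p : E) : 'M[R]_n :=
  \matrix_(j, k) 'D_(xdir j) ('D_(xdir k) u) p.

Definition d2t (u : E -> R) (p : E) : R := 'D_tdir ('D_tdir u) p.

(* Coordinates are ordered x_1, ..., x_n, t. *)
Definition xtdir (i : 'I_(n + 1)) : E :=
  match fintype.split i with inl j => xdir j | inr _ => tdir end.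

Definition hess_xt (u : E -> R) (p : E) : 'M[R]_(n + 1) :=
  \matrix_(i, j) 'D_(xtdir i) ('D_(xtdir j) u) p.

Definition I_x : 'M[R]_(n + 1) := block_mx 1%:M 0 0 0.

(* Space of the second derivatives (u_tt, (u_tx_j)_j, (u_x_jx_k)_jk).  The last
   component ranges over all n x n matrices, so that the n^2 partial derivatives
   in the symbol below make sense; a C^1 function of symmetric matrices is
   extended by H |-> (H + H^T) / 2, and the symbol at a symmetric matrix, being
   the derivative in the direction (tau^2, tau xi, xi^T xi), does not depend on
   the extension. *)
Local Notation J := (R * 'rV[R]_n * 'M[R]_n)%type.

Definition jet2 (u : E -> R) (p : E) : J :=
  (d2t u p, \row_j 'D_(xdir j) ('D_tdir u) p, hess_x u p).

Definition symbol (F : J -> R) (a : J) (tau : R) (xi : 'rV[R]_n) : R :=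
  'D_((1, 0, 0) : J) F a * tau ^+ 2
  + \sum_j 'D_((0, delta_mx 0 j, 0) : J) F a * tau * xi 0 j
  + \sum_j \sum_k 'D_((0, 0, delta_mx j k) : J) F a * xi 0 j * xi 0 k.

Definition definite (Q : R -> 'rV[R]_n -> R) : Prop :=
  (forall tau xi, (tau, xi) != 0 -> 0 < Q tau xi) \/
  (forall tau xi, (tau, xi) != 0 -> Q tau xi < 0).

(* Differentiability of F at the second derivatives of u is what gives the
   linearization a meaning ('D_v is total). *)
Definition elliptic (F : J -> R) (u : E -> R) : Prop :=
  forall p, strip p ->
    differentiable F (jet2 u p) /\ definite (symbol F (jet2 u p)).

Definition change_var (u : E -> R) (p : E) : E := (grad_x u p + p.1, p.2).

(* x(y, s) for q = (y, s). *)
Definition xcoord (u : E -> R) (q : E) : 'rV[R]_n :=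
  get [set x | q.1 = grad_x u (x, q.2) + x].

(* The norm of the library on 'rV is the sup norm, hence the explicit sum. *)
Definition plegendre (u : E -> R) (q : E) : R :=
  let x := xcoord u q in
  - (2^-1 * \sum_j (x 0 j - q.1 0 j) ^+ 2) - u (x, q.2).

Definition Ftilde (F : J -> R) (a : J) : R :=
  let: (q, p, H) := a in
  let h := invmx (H + 1%:M) in
  F (- q + \sum_j \sum_k h j k * p 0 j * p 0 k,
     \row_j (- \sum_k h k j * p 0 k),
     h - 1%:M).

End PartialLegendre.

Arguments strip {R n}.
Arguments I_x {R n}.

(* Main.v *)
Require Import Defs.
From mathcomp Require Import ring lra.

(* With M = D_x^2 u + I and b the row of the u_{t x_j}, the map
   G(x, t) = grad_x u + x is differentiable with differential
   (v, s) |-> v M + s b.  Positivity of M makes G(., t) strictly monotone, hence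
   injective; it is onto because u(., t), being periodic, is bounded below, so
   that u + |x|^2 / 2 - x.y attains its minimum.  The inverse x(y, s) is
   differentiable with differential (w, s) |-> (w - s b) M^-1, and the terms in
   dx cancel in df = (x - y).dy - u_t ds.  Differentiating once more,
     f_ss = b M^-1 b^T - u_tt,  f_{s y} = - b M^-1,  D_y^2 f + I = M^-1,
   from which everything follows: the second derivatives of u are the image of
   those of f under the substitution in Ftilde, the determinant of
   D_{x,t}^2 u + I_x is det M (u_tt - b M^-1 b^T), and by the chain rule the
   symbol of Ftilde at (tau, xi) is minus that of F at (tau - eta.p, eta), where
   eta = xi M. *)

Set Implicit Arguments.
Unset Strict Implicit.
Unset Printing Implicit Defensive.

Import Order.TTheory GRing.Theory Num.Theory.

Local Open Scope classical_set_scope.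
Local Open Scope ring_scope.

(** * Calculus of differentials for vector-valued and matrix-valued maps *)

Section Differentials.
Context {R : realType}.
Implicit Types V W : normedModType R.

Lemma differentiable_near0 V W (f : V -> W) x (e : R) :
  differentiable f x -> 0 < e ->
  \forall h \near (0 : V), `|f (h + x) - f x - 'd f x h| <= e * `|h|.
Proof.
move=> df e0.
have /eqaddoP/(_ _ e0) := diff_locally df.
by apply: filterS => h /=; rewrite !fctE /= opprD addrA.
Qed.

(** The estimate is a first-order expansion with continuous linear part L, and such a part is
    unique. This gives the differential of a map that is known only through inequalities, such as
    the inverse x(y, s). *)
Lemma is_diff_near0 V W (f : V -> W) x (L : {linear V -> W}) :
  continuous L ->
  (forall e : R, 0 < e ->
     \forall h \near (0 : V), `|f (h + x) - f x - L h| <= e * `|h|) ->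
  is_diff x f L.
Proof.
move=> cL fL.
have fo : f \o shift x = cst (f x) + L +o_ (0 : V) id.
  apply/eqaddoP => e e0; apply: filterS (fL e e0) => h /=.
  by rewrite !fctE /= opprD addrA.
have dL : 'd f x = L :> (V -> W) by exact: diff_unique.
by apply: DiffDef => //; apply/diff_locallyP; rewrite dL.
Qed.

Lemma near_is_diff V W (f g : V -> W) x (df : V -> W) :
  (\forall y \near x, f y = g y) -> is_diff x f df -> is_diff x g df.
Proof.
move=> fg [dfx <-].
apply: is_diff_near0; first exact: diff_continuous.
move=> e e0; have := differentiable_near0 dfx e0.
have : \forall h \near (0 : V), f (h + x) = g (h + x).
  by move: fg; rewrite (near_shift 0 x) subr0.
apply: filterS2 => h <-.
by rewrite (nbhs_singleton fg).
Qed.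

Lemma is_diff_sum V W I (r : seq I) (P : pred I) (f df : I -> V -> W) x :
  (forall i, P i -> is_diff x (f i) (df i)) ->
  is_diff x (fun y => \sum_(i <- r | P i) f i y)
            (fun h => \sum_(i <- r | P i) df i h).
Proof.
move=> fdf; elim: r => [|i r IH].
  under eq_fun do rewrite big_nil.
  under [X in is_diff _ _ X]eq_fun do rewrite big_nil.
  exact: is_diff_cst.
under eq_fun do rewrite big_cons.
under [X in is_diff _ _ X]eq_fun do rewrite big_cons.
by case Pi : (P i) => //; exact: is_diffD (fdf _ Pi) IH.
Qed.

Lemma is_diff_coord V m n (M dM : V -> 'M[R]_(m, n)) x i j :
  is_diff x M dM -> is_diff x (fun y => M y i j) (fun h => dM h i j).
Proof.
move=> [dMx <-].
have dc := differentiable_coord (M x) i j.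
have dD : differentiable (fun y => M y i j) x.
  exact: (differentiable_comp dMx dc).
apply: DiffDef => //.
apply/funext => h; rewrite -!deriveE // derive_mx ?mxE //.
exact: diff_derivable.
Qed.

(** Differentiability comes from expanding M as the finite sum of its entries times the elementary
    matrices; the differential is then identified entry by entry. *)
Lemma is_diff_mx V m n (M dM : V -> 'M[R]_(m, n)) x :
  (forall i j, is_diff x (fun y => M y i j) (fun h => dM h i j)) ->
  is_diff x M dM.
Proof.
move=> MdM.
have ME : M = fun y => \sum_i \sum_j M y i j *: delta_mx i j.
  by apply/funext => y; exact: matrix_sum_delta.
have dMx : differentiable M x.
  rewrite ME.
  suff [] : is_diff x (fun y => \sum_i \sum_j M y i j *: delta_mx i j)
    (fun h => \sum_i \sum_j
       'd (fun y => M y i j) x h *: (delta_mx i j : 'M[R]_(m, n))) by [].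
  apply: is_diff_sum => i _; apply: is_diff_sum => j _.
  have [Mij _] := MdM i j.
  by apply: DiffDef; [exact: differentiableZl | rewrite diffZl].
apply: DiffDef => //; apply/funext => h.
rewrite -deriveE // derive_mx; last exact: diff_derivable.
apply/matrixP => i j; rewrite mxE.
by rewrite deriveE // (diff_val (is_diff_def := MdM i j)).
Qed.

Lemma is_diff_mul V (f g df dg : V -> R) x :
  is_diff x f df -> is_diff x g dg ->
  is_diff x (fun y => f y * g y) (fun h => f x * dg h + df h * g x).
Proof.
move=> fd gd; apply: (is_diff_eq (is_diffM fd gd)).
by apply/funext => h; rewrite !fctE /= [df h * _]mulrC.
Qed.

Lemma is_diff_fst V W (x : V * W) : is_diff x fst fst.
Proof.
pose L := (fst : {linear (V * W)%type -> V}).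
have cL : continuous L by move=> y; exact: cvg_fst.
apply: DiffDef; first exact: (linear_differentiable (f := L)).
exact: (diff_lin (f := L)).
Qed.

Lemma is_diff_snd V W (x : V * W) : is_diff x snd snd.
Proof.
pose L := (snd : {linear (V * W)%type -> W}).
have cL : continuous L by move=> y; exact: cvg_snd.
apply: DiffDef; first exact: (linear_differentiable (f := L)).
exact: (diff_lin (f := L)).
Qed.

Lemma is_diff_mulmx V m n p (A dA : V -> 'M[R]_(m, n))
    (B dB : V -> 'M[R]_(n, p)) x :
  is_diff x A dA -> is_diff x B dB ->
  is_diff x (fun y => A y *m B y) (fun h => A x *m dB h + dA h *m B x).
Proof.
move=> Ad Bd; apply: is_diff_mx => i j.
under eq_fun do rewrite mxE.
under [X in is_diff _ _ X]eq_fun do rewrite !mxE -big_split /=.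
by apply: is_diff_sum => k _; apply: is_diff_mul; exact: is_diff_coord.
Qed.

Lemma is_diff_trmx V m n (A dA : V -> 'M[R]_(m, n)) x :
  is_diff x A dA -> is_diff x (fun y => (A y)^T) (fun h => (dA h)^T).
Proof.
move=> Ad; apply: is_diff_mx => i j.
under eq_fun do rewrite mxE.
under [X in is_diff _ _ X]eq_fun do rewrite mxE.
exact: is_diff_coord.
Qed.

Lemma differentiable_bigsum V W I (r : seq I) (P : pred I) (f : I -> V -> W) x :
  (forall i, differentiable (f i) x) ->
  differentiable (fun y => \sum_(i <- r | P i) f i y) x.
Proof.
move=> fd; suff [] : is_diff x (fun y => \sum_(i <- r | P i) f i y)
  (fun h => \sum_(i <- r | P i) 'd (f i) x h) by [].
by apply: is_diff_sum => i _; exact: differentiableP.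
Qed.

Lemma differentiable_prod V I (r : seq I) (f : I -> V -> R) x :
  (forall i, differentiable (f i) x) ->
  differentiable (fun y => \prod_(i <- r) f i y) x.
Proof.
move=> fd; elim: r => [|i r IH].
  under eq_fun do rewrite big_nil; exact: differentiable_cst.
under eq_fun do rewrite big_cons; exact: differentiableM.
Qed.

Lemma differentiable_entry V m n (A : V -> 'M[R]_(m, n)) x i j :
  differentiable A x -> differentiable (fun y => A y i j) x.
Proof. by move=> /differentiableP /(is_diff_coord i j) []. Qed.

Lemma differentiable_det V n (A : V -> 'M[R]_n) x :
  differentiable A x -> differentiable (fun y => \det (A y)) x.
Proof.
move=> Ad; apply: differentiable_bigsum => s; apply: differentiableM.
  exact: differentiable_cst.
apply: differentiable_prod => i.
exact: differentiable_entry.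
Qed.

Lemma differentiable_mx V m n (A : V -> 'M[R]_(m, n)) x :
  (forall i j, differentiable (fun y => A y i j) x) -> differentiable A x.
Proof.
move=> Ad; suff [] : is_diff x A (fun h => \matrix_(i, j)
  'd (fun y => A y i j) x h) by [].
apply: is_diff_mx => i j.
by under [X in is_diff _ _ X]eq_fun do rewrite mxE; exact: differentiableP.
Qed.

Lemma differentiable_adj V n (A : V -> 'M[R]_n) x :
  differentiable A x -> differentiable (fun y => \adj (A y)) x.
Proof.
move=> Ad; apply: differentiable_mx => i j.
under eq_fun do rewrite mxE /cofactor.
apply: differentiableM; first exact: differentiable_cst.
apply: differentiable_det; apply: differentiable_mx => k l.
by under eq_fun do rewrite !mxE; exact: differentiable_entry.
Qed.

Lemma near_unitmx V n (A : V -> 'M[R]_n) x :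
  {for x, continuous (fun y => \det (A y))} -> A x \in unitmx ->
  \forall y \near x, A y \in unitmx.
Proof.
move=> cA; rewrite unitmxE unitfE => dA0.
have : \forall y \near x, \det (A y) != 0 by exact: cvgr_neq0 cA dA0.
by apply: filterS => y; rewrite unitmxE unitfE.
Qed.

(** Near x the determinant does not vanish, so Cramer's formula, adjugate over determinant, gives
    differentiability. The value of the differential then comes from differentiating the identity A
    A^-1 = 1. *)
Lemma is_diff_invmx V n (A dA : V -> 'M[R]_n) x :
  is_diff x A dA -> A x \in unitmx ->
  is_diff x (fun y => invmx (A y))
    (fun h => - (invmx (A x) *m dA h *m invmx (A x))).
Proof.
move=> AdA uA; have [Ad _] := AdA.
have dd := differentiable_det Ad.
have nu : \forall y \near x, A y \in unitmx.
  exact: near_unitmx (differentiable_continuous dd) uA.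
have di : is_diff x (fun y => invmx (A y))
    ('d (fun y => (\det (A y))^-1 *: \adj (A y)) x).
  apply: (near_is_diff (f := fun y => (\det (A y))^-1 *: \adj (A y))).
    by apply: filterS nu => y uy; rewrite /invmx uy.
  apply: differentiableP; apply: differentiable_mx => i j.
  under eq_fun do rewrite mxE.
  apply: differentiableM.
    by apply: differentiableV => //; rewrite -unitfE -unitmxE.
  exact/differentiable_entry/differentiable_adj.
have := is_diff_mulmx AdA di.
(* The product agrees near x with a constant, so its differential is 0; solving that relation for
   the differential of the inverse finishes the proof. *)
have /(near_is_diff (g := cst (1%:M : 'M[R]_n))) h :
    \forall y \near x, A y *m invmx (A y) = cst 1%:M y.
  by apply: filterS nu => y uy; rewrite mulmxV.
move=> /h [_ e]; have := diff_cst (1%:M : 'M[R]_n) x.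
rewrite e => e'.
apply: is_diff_eq di _.
apply/funext => v; have /= := congr1 (fun f => invmx (A x) *m f v) e'.
rewrite mulmxDr mulKmx // mulmx0 => /eqP; rewrite addr_eq0 => /eqP ->.
by rewrite mulmxA.
Qed.

Lemma continuous_invmx n (A : 'M[R]_n) :
  A \in unitmx -> {for A, continuous (@invmx R n)}.
Proof.
move=> uA; apply: differentiable_continuous.
by have [] := is_diff_invmx (is_diff_id A) uA.
Qed.

Lemma continuous_entries (T : topologicalType) m n (A : T -> 'M[R]_(m, n)) x :
  (forall i j, {for x, continuous (fun y => A y i j)}) ->
  {for x, continuous A}.
Proof.
move=> Ac; apply/cvgrPdist_le => e e0.
have : \forall y \near x, forall ij : 'I_m * 'I_n,
    `|A x ij.1 ij.2 - A y ij.1 ij.2| <= e.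
  apply: filter_forall => ij.
  by move/cvgrPdist_le : (Ac ij.1 ij.2) => /(_ _ e0).
apply: filterS => y Ay.
rewrite [leLHS]/Num.Def.normr/= mx_normrE (bigmax_le _ (ltW e0)) //= => ij _.
by rewrite !mxE.
Qed.

Lemma continuous_mulmx (T : topologicalType) m n p (A : T -> 'M[R]_(m, n))
    (B : T -> 'M[R]_(n, p)) x :
  {for x, continuous A} -> {for x, continuous B} ->
  {for x, continuous (fun y => A y *m B y)}.
Proof.
move=> Ac Bc.
have AB : {for x, continuous (fun y => (A y, B y))}.
  exact: (cvg_pair (FF := nbhs_filter x) (FG := nbhs_filter _)
    (FH := nbhs_filter _) Ac Bc).
suff M : {for (A x, B x), continuous
    (fun y : 'M[R]_(m, n) * 'M[R]_(n, p) => y.1 *m y.2)}.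
  exact: (continuous_comp AB M).
apply: differentiable_continuous.
by have [] := is_diff_mulmx (is_diff_fst (A x, B x)) (is_diff_snd (A x, B x)).
Qed.

(** * Derivatives along lines and symmetry of second derivatives *)

Lemma is_diff_is_derive V W (f df : V -> W) x v :
  is_diff x f df -> is_derive x v f (df v).
Proof.
move=> [fx <-]; apply: DeriveDef; first exact: diff_derivable.
by rewrite deriveE.
Qed.

Lemma is_diff_line V (v p : V) (t : R) :
  is_diff t (fun s : R => s *: v + p) (fun h => h *: v).
Proof.
have : is_diff t (fun s : R => s *: v + p) ((fun h => h *: v) + (0 : R -> V)).
  exact: (is_diffD (is_diff_scalel t v) (is_diff_cst p t)).
by rewrite addr0.
Qed.

Lemma is_derive_line V W (f : V -> W) (v p : V) (t : R) :
  differentiable f (t *: v + p) ->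
  is_derive t 1 (fun s : R => f (s *: v + p)) ('D_v f (t *: v + p)).
Proof.
move=> df.
have := is_diff_is_derive (1 : R)
  (is_diff_comp (is_diff_line v p t) (differentiableP df)).
rewrite /= scale1r.
by rewrite -deriveE.
Qed.

(* Only differentiability of 'D_v u at p is used, so that exchanging v and w
   gives the symmetry of second derivatives. *)
Lemma second_difference V (u : V -> R) p v w (e : R) :
  (\forall y \near p, differentiable u y) -> differentiable ('D_v u) p ->
  0 < e ->
  exists2 d : R, 0 < d & forall h, 0 < h < d ->
    `|u (h *: v + (h *: w + p)) - u (h *: w + p) - u (h *: v + p) + u p
      - h * (h * 'D_w ('D_v u) p)| <= e * (h * h).
Proof.
move=> du dv e0.
(* For 0 <= c <= h the norms of c v and of c v + h w add up to at most h N; the summand 1 keeps N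
   positive. *)
pose N := 2 * `|v| + `|w| + 1.
have N0 : 0 < N by rewrite /N; have := normr_ge0 v; have := normr_ge0 w; lra.
have e'0 : 0 < e / N by rewrite divr_gt0.
have := differentiable_near0 dv e'0.
have : \forall k \near (0 : V), differentiable u (k + p).
  by move: du; rewrite (near_shift 0 p) subr0.
move=> n1 n2; have : \forall k \near (0 : V), differentiable u (k + p) /\
    `|'D_v u (k + p) - 'D_v u p - 'd ('D_v u) p k| <= e / N * `|k|.
  by near do split.
move=> /nbhs_normP [r /= r0 rP].
exists (r / N) => [|h /andP[h0 hr]]; first by rewrite divr_gt0.
have hN : h * N < r by rewrite -ltr_pdivlMr.
have kP k : `|k| < r -> differentiable u (k + p) /\
    `|'D_v u (k + p) - 'D_v u p - 'd ('D_v u) p k| <= e / N * `|k|.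
  by move=> kr; apply: rP; rewrite /= sub0r normrN.
have sm1 c : 0 <= c <= h -> `|c *: v| < r /\ `|c *: v + h *: w| < r /\
    `|c *: v| + `|c *: v + h *: w| <= h * N.
  move=> /andP[c0 ch].
  have := ler_normD (c *: v) (h *: w).
  rewrite !normrZ (ger0_norm c0) (gtr0_norm h0).
  have : c * `|v| <= h * `|v| by rewrite ler_wpM2r.
  have := mulr_ge0 c0 (normr_ge0 v).
  have := mulr_ge0 (ltW h0) (normr_ge0 w).
  by move: hN; rewrite /N !mulrDr; move=> *; repeat split; nra.
(* The second difference is g h - g 0. The mean value theorem along v turns it into h times a first
   difference of ['D_v u] in the direction h w. *)
pose g s := u (s *: v + (h *: w + p)) - u (s *: v + p).
have gd s : 0 <= s <= h -> is_derive s 1 g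
   ('D_v u (s *: v + (h *: w + p)) - 'D_v u (s *: v + p)).
  move=> /sm1[s1 [s2 _]]; apply: is_deriveB; apply: is_derive_line.
    by rewrite addrA; exact: (kP _ s2).1.
  exact: (kP _ s1).1.
have [||c + gE] := @MVT R g (fun s =>
  'D_v u (s *: v + (h *: w + p)) - 'D_v u (s *: v + p)) 0 h h0.
- by move=> s; rewrite in_itv /= => /andP[s1 s2]; apply: gd; rewrite !ltW.
- apply: derivable_within_continuous => s; rewrite in_itv /= => hs.
  by have [] := gd s hs.
rewrite in_itv /= => /andP[c0 ch].
have [s1 [s2 s3]] : `|c *: v| < r /\ `|c *: v + h *: w| < r /\
    `|c *: v| + `|c *: v + h *: w| <= h * N by apply: sm1; rewrite !ltW.
have -> : u (h *: v + (h *: w + p)) - u (h *: w + p) - u (h *: v + p) + u p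
    = g h - g 0.
  by rewrite /g !scale0r !add0r; ring.
rewrite gE subr0 [_ * h]mulrC -mulrBr normrM (gtr0_norm h0).
rewrite mulrCA ler_pM2l // (deriveE w dv).
have [_ e1] := kP _ s1; have [_ ] := kP _ s2.
rewrite linearD ['d _ _ (h *: w)]linearZ /= => e2.
rewrite addrA.
(* Both values of ['D_v u] are linearized at p: the parts linear in c v cancel, and the two
   remainders add up to at most e h. *)
have -> : 'D_v u (c *: v + h *: w + p) - 'D_v u (c *: v + p)
    - h * 'd ('D_v u) p w
  = ('D_v u (c *: v + h *: w + p) - 'D_v u p -
       ('d ('D_v u) p (c *: v) + h *: 'd ('D_v u) p w))
    - ('D_v u (c *: v + p) - 'D_v u p - 'd ('D_v u) p (c *: v)).
  by rewrite (_ : h *: 'd ('D_v u) p w = h * 'd ('D_v u) p w) //; ring.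
apply: le_trans (ler_normB _ _) _; apply: le_trans (lerD e2 e1) _.
rewrite -mulrDr [_ + `|c *: v|]addrC.
apply: le_trans (ler_wpM2l (ltW e'0) s3) _.
by rewrite (mulrC h) mulrA divfK ?gt_eqF.
Unshelve. all: end_near.
Qed.

(** The second difference in v and w is symmetric in the two directions, and h^2 times either mixed
    derivative approximates it with error at most (e / 2) h^2. Hence the two derivatives differ by
    at most e, for every e > 0. *)
Lemma derive_comm V (u : V -> R) p v w :
  (\forall y \near p, differentiable u y) ->
  differentiable ('D_v u) p -> differentiable ('D_w u) p ->
  'D_w ('D_v u) p = 'D_v ('D_w u) p.
Proof.
move=> du dv dw; apply/eqP; rewrite -subr_eq0 -normr_le0.
apply/ler_addgt0Pr => e e0; rewrite add0r.
have e2 : 0 < e / 2 by rewrite divr_gt0.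
have [d1 d10 h1] := second_difference w du dv e2.
have [d2 d20 h2] := second_difference v du dw e2.
pose h := Num.min d1 d2 / 2.
have m0 : 0 < Num.min d1 d2 by rewrite lt_min d10.
have hm : h < Num.min d1 d2 by rewrite /h; lra.
have h0 : 0 < h by rewrite /h; lra.
move: hm; rewrite lt_min => /andP[hd1 hd2].
have := h1 h; have := h2 h; rewrite h0 hd1 hd2 => /(_ isT) k2 /(_ isT) k1.
rewrite -(@ler_pM2l _ (h * h)) ?mulr_gt0 //.
rewrite -[X in X * `|_|]gtr0_norm ?mulr_gt0 // -normrM.
have aux (k a b x y z t : R) : k * k * (a - b) =
    (x - y - z + t - k * (k * b)) - (x - z - y + t - k * (k * a)) by ring.
have -> : h * h * ('D_w ('D_v u) p - 'D_v ('D_w u) p) =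
 (u (h *: w + (h *: v + p)) - u (h *: v + p) - u (h *: w + p) + u p
   - h * (h * 'D_v ('D_w u) p)) -
 (u (h *: v + (h *: w + p)) - u (h *: w + p) - u (h *: v + p) + u p
   - h * (h * 'D_w ('D_v u) p)).
  by rewrite (addrCA (h *: w)); exact: aux.
apply: le_trans (ler_normB _ _) _; apply: le_trans (lerD k2 k1) _.
by rewrite -mulrDl -splitr mulrC.
Qed.

End Differentials.

(** * The Euclidean inner product and positive definite matrices *)

Definition dot (R : realType) n (v w : 'rV[R]_n) : R := (v *m w^T) 0 0.

Section Dot.
Context {R : realType} {n : nat}.
Implicit Types (u v w : 'rV[R]_n) (A : 'M[R]_n).

Lemma dotE v w : dot v w = \sum_j v 0 j * w 0 j.
Proof. by rewrite /dot mxE; apply: eq_bigr => j _; rewrite mxE. Qed.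

Lemma dotC v w : dot v w = dot w v.
Proof. by rewrite !dotE; apply: eq_bigr => j _; rewrite mulrC. Qed.

Lemma dotDl u v w : dot (u + v) w = dot u w + dot v w.
Proof. by rewrite /dot mulmxDl mxE. Qed.

Lemma dotZl (a : R) v w : dot (a *: v) w = a * dot v w.
Proof. by rewrite /dot -scalemxAl mxE. Qed.

Lemma dotNl v w : dot (- v) w = - dot v w.
Proof. by rewrite /dot mulNmx mxE. Qed.

Lemma dotBl u v w : dot (u - v) w = dot u w - dot v w.
Proof. by rewrite dotDl dotNl. Qed.

Lemma dot0l v : dot 0 v = 0.
Proof. by rewrite /dot mul0mx mxE. Qed.

Lemma dot0r v : dot v 0 = 0.
Proof. by rewrite dotC dot0l. Qed.

Lemma dotDr u v w : dot u (v + w) = dot u v + dot u w.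
Proof. by rewrite ![dot u _]dotC dotDl. Qed.

Lemma dotZr (a : R) v w : dot v (a *: w) = a * dot v w.
Proof. by rewrite ![dot v _]dotC dotZl. Qed.

Lemma dotNr v w : dot v (- w) = - dot v w.
Proof. by rewrite ![dot v _]dotC dotNl. Qed.

Lemma dotBr u v w : dot u (v - w) = dot u v - dot u w.
Proof. by rewrite dotDr dotNr. Qed.

Lemma dot_delta v j : dot v (delta_mx 0 j) = v 0 j.
Proof.
rewrite dotE (bigD1 j) //= mxE !eqxx mulr1 big1 ?addr0 // => i ij.
by rewrite mxE (negbTE ij) andbF mulr0.
Qed.

Lemma dot_mulmx v w A : dot (v *m A) w = dot v (w *m A^T).
Proof. by rewrite /dot trmx_mul trmxK mulmxA. Qed.

Lemma le_mx_norm m p (M : 'M[R]_(m, p)) i j : `|M i j| <= `|M|.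
Proof.
rewrite [leRHS]/Num.Def.normr /= mx_normrE.
exact: (le_bigmax _ (fun ij => `|M ij.1 ij.2|) (i, j)).
Qed.

(** A Cauchy-Schwarz bound with respect to the sup norm, which costs the factor n. *)
Lemma dot_le v w : `|dot v w| <= n%:R * (`|v| * `|w|).
Proof.
rewrite dotE; apply: le_trans (ler_norm_sum _ _ _) _.
rewrite -[X in X%:R * _]card_ord mulr_natl -sumr_const.
apply: ler_sum => j _.
by rewrite normrM ler_pM // le_mx_norm.
Qed.

(** The sup norm is attained at some entry, whose square is one term of the sum. *)
Lemma norm_le_dot v : `|v| * `|v| <= dot v v.
Proof.
have [->|v0] := eqVneq v 0.
  by rewrite normr0 mul0r dotE sumr_ge0 // => j _; exact: sqr_ge0.
have : mx_norm v != 0 by apply: contra_neq v0; exact: mx_norm_eq0.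
move=> /mx_norm_neq0 [[i j] /= vE]; have -> : `|v| = `|v 0 j|.
  by rewrite [LHS]/Num.Def.normr /= vE ord1.
rewrite -normrM ger0_norm ?sqr_ge0 // dotE (bigD1 j) //= lerDl.
by apply: sumr_ge0 => k _; exact: sqr_ge0.
Qed.

(** The constant c is the minimum of the quadratic form on the unit sphere of the sup norm, which is
    compact; homogeneity extends the bound to all v. *)
Lemma posdef_coercive A : posdef A ->
  exists2 c : R, 0 < c & forall v, c * (`|v| * `|v|) <= dot (v *m A) v.
Proof.
move=> [_ Apos]; pose S := [set v : 'rV[R]_n | `|v| = 1].
(* The sphere is empty when n = 0; then 0 is the only vector and any c works. *)
have [S0|/set0P S0] := eqVneq S set0.
  exists 1 => // v; have [->|v0] := eqVneq v 0.
    by rewrite normr0 !mulr0 mul0mx /dot mul0mx mxE.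
  have : S (`|v|^-1 *: v).
    by rewrite /S /= normrZ normfV normr_id mulVf // normr_eq0.
  by rewrite S0.
have cq : continuous (fun v : 'rV[R]_n => dot (v *m A) v).
  move=> v; apply: differentiable_continuous; apply: differentiable_entry.
  have [] // := is_diff_mulmx (is_diff_mulmx (is_diff_id v) (is_diff_cst A v))
    (is_diff_trmx (is_diff_id v)).
have Sc : compact S.
  apply: bounded_closed_compact.
    exists 1; split; first exact: num_real.
    by move=> M M1 v /= ->; exact: ltW.
  apply: (@closed_comp _ _ (fun v : 'rV[R]_n => `|v|) [set 1]).
    by move=> v _; exact: norm_continuous.
  exact: closed_eq.
have [|v0 + vmin] := EVT_min_rV S0 Sc (f := fun v => dot (v *m A) v).
  exact: continuous_subspaceT.
rewrite inE /S /= => v01.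
have v00 : v0 != 0 by rewrite -normr_eq0 v01 oner_eq0.
exists (dot (v0 *m A) v0); first exact: Apos.
move=> v; have [->|vn0] := eqVneq v 0.
  by rewrite normr0 !mulr0 mul0mx /dot mul0mx mxE.
have nv : 0 < `|v| by rewrite normr_gt0.
have := vmin (`|v|^-1 *: v).
rewrite inE /S /= normrZ normfV normr_id mulVf ?gt_eqF // => /(_ erefl).
rewrite -scalemxAl dotZl dotZr mulrA -invfM => h.
by rewrite -ler_pdivlMr ?mulr_gt0 // mulrC.
Qed.

Lemma posdef_unitmx A : posdef A -> A \in unitmx.
Proof.
move=> [_ Apos]; rewrite -row_free_unit -kermx_eq0.
apply/eqP/row_matrixP => i; rewrite row0; apply/eqP; apply: contraT => /Apos.
by rewrite -row_mul mulmx_ker row0 mul0mx mxE ltxx.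
Qed.

(** The form of A^-1 at v is the form of A at v A^-1. *)
Lemma posdef_invmx A : posdef A -> posdef (invmx A).
Proof.
move=> pA; have uA := posdef_unitmx pA; have [sA Apos] := pA.
split=> [|v v0]; first by rewrite trmx_inv sA.
have vA0 : v *m invmx A != 0.
  by apply: contra_neq v0 => e; rewrite -(mulmxKV uA v) e mul0mx.
have := Apos _ vA0.
by rewrite mulmxKV // trmx_mul trmx_inv sA mulmxA.
Qed.

End Dot.

Lemma is_diff_dot (R : realType) (V : normedModType R) n
    (v dv w dw : V -> 'rV[R]_n) x :
  is_diff x v dv -> is_diff x w dw ->
  is_diff x (fun y => dot (v y) (w y))
    (fun h => dot (v x) (dw h) + dot (dv h) (w x)).
Proof.
move=> vd wd.
have := is_diff_coord 0 0 (is_diff_mulmx vd (is_diff_trmx wd)).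
by move=> /is_diff_eq; apply; apply/funext => h; rewrite mxE.
Qed.

Lemma near_continuous (T U : topologicalType) (f g : T -> U) (x : T) :
  (\forall y \near x, f y = g y) -> {for x, continuous f} ->
  {for x, continuous g}.
Proof.
move=> fg; rewrite /prop_for /continuous_at -(nbhs_singleton fg) => fc.
by apply: cvg_trans fc; apply: near_eq_cvg; apply: filterS fg => y ->.
Qed.

Lemma continuous_dot (R : realType) (T : topologicalType) m
    (v w : T -> 'rV[R]_m) (x : T) :
  {for x, continuous v} -> {for x, continuous w} ->
  {for x, continuous (fun y => dot (v y) (w y))}.
Proof.
move=> vc wc.
have vw : {for x, continuous (fun y => (v y, w y))}.
  exact: (cvg_pair (FF := nbhs_filter x) (FG := nbhs_filter _)
    (FH := nbhs_filter _) vc wc).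
suff d : {for (v x, w x), continuous
    (fun y : 'rV[R]_m * 'rV[R]_m => dot y.1 y.2)}.
  exact: (continuous_comp vw d).
apply: differentiable_continuous.
by have [] := is_diff_dot (is_diff_fst (v x, w x)) (is_diff_snd (v x, w x)).
Qed.

(** * Differentials on R^n x R in the coordinates (x, t) *)

Section Coordinates.
Context {R : realType} {n : nat}.
Local Notation E := ('rV[R]_n * R)%type.
Local Notation dx := (@xdir R n).
Local Notation dt := (tdir R n).
Implicit Types (u : E -> R) (p h : E).

(** The order of differentiation is the one that appears in the differential of [grad_x u];
    [grad_tE] exchanges it for the order used in [jet2]. *)
Definition grad_t u p : 'rV[R]_n := \row_j 'D_dt ('D_(dx j) u) p.

Lemma pair_coords h : h = \sum_j h.1 0 j *: dx j + h.2 *: dt.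
Proof.
have s1 (I : finType) (f : I -> E) : (\sum_i f i).1 = \sum_i (f i).1.
  exact: (raddf_sum (fst : {additive E -> 'rV[R]_n})).
have s2 (I : finType) (f : I -> E) : (\sum_i f i).2 = \sum_i (f i).2.
  exact: (raddf_sum (snd : {additive E -> R})).
rewrite [LHS]surjective_pairing [RHS]surjective_pairing; congr pair => /=.
  by rewrite s1 scaler0 addr0 -row_sum_delta.
rewrite s2 big1 ?add0r => [|j _]; last by rewrite /= scaler0.
by rewrite -[RHS]/(_ * 1) mulr1.
Qed.

Lemma diff_coords u p h : differentiable u p ->
  'd u p h = dot h.1 (grad_x u p) + h.2 * 'D_dt u p.
Proof.
move=> du; rewrite {1}(pair_coords h) linearD linear_sum linearZ /=.
rewrite deriveE // dotE; congr (_ + _).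
by apply: eq_bigr => j _; rewrite linearZ mxE deriveE.
Qed.

Lemma is_diff_grad_x u p :
  (forall j, differentiable ('D_(dx j) u) p) ->
  is_diff p (grad_x u) (fun h => h.1 *m hess_x u p + h.2 *: grad_t u p).
Proof.
move=> du; apply: is_diff_mx => i j; rewrite ord1.
under eq_fun do rewrite mxE.
apply: (is_diff_eq (differentiableP (du j))); apply/funext => h.
rewrite diff_coords // !mxE dotE; congr (_ + _).
by apply: eq_bigr => k _; rewrite !mxE.
Qed.

Lemma open_strip : open (@strip R n).
Proof.
have -> : @strip R n = [set p | 0 < p.2] `&` [set p | p.2 < 1].
  by apply/seteqP; split => p; [move=> /andP[] | move=> [/= h1 h2]; apply/andP].
apply: openI.
  apply: (@open_comp _ _ (@snd 'rV[R]_n R) [set y | 0 < y]);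
    last exact: open_gt.
  by move=> x _; exact: cvg_snd.
apply: (@open_comp _ _ (@snd 'rV[R]_n R) [set y | y < 1]); last exact: open_lt.
by move=> x _; exact: cvg_snd.
Qed.

Lemma near_strip p : strip p -> \forall q \near p, strip q.
Proof. by move=> sp; apply: open_nbhs_nbhs; split => //; exact: open_strip. Qed.

End Coordinates.

(** * Ellipticity under the substitution of second derivatives *)

Section Symbol.
Context {R : realType} {n : nat}.
Local Notation J := (R * 'rV[R]_n * 'M[R]_n)%type.
Implicit Types (F : J -> R) (a k : J) (p xi : 'rV[R]_n) (h : 'M[R]_n).

(** Expand the direction (tau^2, tau xi, xi^T xi) in the standard basis and use linearity of the
    differential. In this form the symbol is open to the chain rule. *)
Lemma symbolE F a (tau : R) xi : differentiable F a ->
  symbol F a tau xi = 'd F a (tau ^+ 2, tau *: xi, xi^T *m xi).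
Proof.
move=> dF; rewrite /symbol.
have s11 (I : finType) (f : I -> J) : (\sum_i f i).1.1 = \sum_i (f i).1.1.
  by rewrite (raddf_sum (fst : {additive J -> _}))
    (raddf_sum (fst : {additive (R * 'rV[R]_n)%type -> R})).
have s12 (I : finType) (f : I -> J) : (\sum_i f i).1.2 = \sum_i (f i).1.2.
  by rewrite (raddf_sum (fst : {additive J -> _}))
    (raddf_sum (snd : {additive (R * 'rV[R]_n)%type -> _})).
have s2 (I : finType) (f : I -> J) : (\sum_i f i).2 = \sum_i (f i).2.
  exact: (raddf_sum (snd : {additive J -> _})).
have -> : ((tau ^+ 2, tau *: xi, xi^T *m xi) : J) =
    tau ^+ 2 *: (1, 0, 0) + \sum_j (tau * xi 0 j) *: (0, delta_mx 0 j, 0)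
    + \sum_j \sum_k (xi 0 j * xi 0 k) *: (0, 0, delta_mx j k).
  rewrite [RHS]surjective_pairing [X in (X, _)]surjective_pairing.
  congr (_, _, _) => /=.
  - rewrite !s11 !big1 ?addr0 => [|j _|j _].
        by rewrite -[RHS]/(_ * 1) mulr1.
      by rewrite s11 big1 // => l _; rewrite /= scaler0.
    by rewrite /= scaler0.
  - rewrite !s12 /= scaler0 add0r [X in _ + X]big1 ?addr0 => [|j _].
      rewrite [in LHS](row_sum_delta xi) scaler_sumr.
      by apply: eq_bigr => j _; rewrite scalerA.
    by rewrite s12 big1 // => l _; rewrite /= scaler0.
  - rewrite !s2 /= scaler0 add0r big1 ?add0r => [|j _]; last first.
      by rewrite /= scaler0.
    rewrite [LHS]matrix_sum_delta; apply: eq_bigr => j _.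
    rewrite s2; apply: eq_bigr => l _ /=.
    by rewrite mxE big_ord1 mxE.
rewrite !linearD !linear_sum linearZ /= [tau ^+ 2 *: _]mulrC -!deriveE //.
congr (_ + _ + _).
  by apply: eq_bigr => j _; rewrite linearZ /= -deriveE // -mulrA mulrC.
apply: eq_bigr => j _; rewrite linear_sum; apply: eq_bigr => l _.
by rewrite linearZ /= -deriveE // -mulrA mulrC.
Qed.

(* The substitution in Ftilde, as a map on second derivatives. *)
Definition jet_map a : J :=
  let h := invmx (a.2 + 1%:M) in
  (- a.1.1 + dot (a.1.2 *m h) a.1.2, - (a.1.2 *m h), h - 1%:M).

Lemma FtildeE F a : Ftilde F a = F (jet_map a).
Proof.
case: a => [[q p] H]; rewrite /Ftilde /jet_map /=; set h := invmx _.
congr (F (_, _, _)).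
  congr (_ + _); rewrite dotE exchange_big /=; apply: eq_bigr => k _.
  rewrite mxE mulr_suml; apply: eq_bigr => j _.
  by rewrite [h j k * _]mulrC.
apply/rowP => j; rewrite !mxE; congr (- _); apply: eq_bigr => k _.
by rewrite mulrC.
Qed.

Lemma is_diff_jet_map a : a.2 + 1%:M \in unitmx ->
  let h := invmx (a.2 + 1%:M) in let p := a.1.2 in
  is_diff a jet_map (fun k =>
    let dh := - (h *m k.2 *m h) in
    (- k.1.1 + (dot (p *m h) k.1.2 + dot (p *m dh + k.1.2 *m h) p),
     - (p *m dh + k.1.2 *m h), dh)).
Proof.
move=> uH h p.
have d1 := is_diff_fst a; have d2 := is_diff_snd a.
have d11 := is_diff_comp d1 (is_diff_fst a.1).
have d12 := is_diff_comp d1 (is_diff_snd a.1).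
have dh : is_diff a (fun k => invmx (k.2 + 1%:M)) (fun k => - (h *m k.2 *m h)).
  have dH := is_diffD d2 (is_diff_cst (1%:M : 'M[R]_n) a).
  have := is_diff_invmx dH uH.
  by move=> /is_diff_eq; apply; apply/funext => k; rewrite !fctE addr0.
have dp := is_diff_mulmx d12 dh.
have db := is_diffB dh (is_diff_cst (1%:M : 'M[R]_n) a).
have d112 := is_diffD (is_diffN d11) (is_diff_dot dp d12).
have := is_diff_pair (is_diff_pair d112 (is_diffN dp)) db.
by move=> /is_diff_eq; apply; apply/funext => k; rewrite !fctE subr0.
Qed.

(* The left-hand side is the differential of jet_map in the direction
   (tau^2, tau xi, xi^T xi). *)
Lemma jet_map_symbol p h (tau : R) xi : h^T = h ->
  let eta := xi *m h in let sigma := tau - dot eta p in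
  let dh := - (h *m (xi^T *m xi) *m h) in
  (- tau ^+ 2 + (dot (p *m h) (tau *: xi)
                  + dot (p *m dh + (tau *: xi) *m h) p),
   - (p *m dh + (tau *: xi) *m h), dh) =
  - (sigma ^+ 2, sigma *: eta, eta^T *m eta) :> J.
Proof.
move=> hT eta sigma dh.
have dhE : dh = - (eta^T *m eta) by rewrite /dh /eta trmx_mul hT !mulmxA.
have pdh : p *m dh = - (dot eta p *: eta).
  rewrite dhE mulmxN mulmxA [p *m eta^T]mx11_scalar mul_scalar_mx.
  by rewrite -[(p *m eta^T) 0 0]/(dot p eta) dotC.
have E : p *m dh + (tau *: xi) *m h = sigma *: eta.
  by rewrite pdh -scalemxAl -/eta /sigma scalerBl addrC.
rewrite E dhE; congr (_, _, _) => /=.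
(* With e = [dot eta p], the first component is - tau^2 + tau e + (tau - e) e = - (tau - e)^2. *)
rewrite dotZl dotZr dot_mulmx hT -/eta [dot p eta]dotC /sigma; ring.
Qed.

(** By the chain rule and [jet_map_symbol], the symbol of [Ftilde F] is minus that of F after the
    linear change (tau, xi) |-> (tau - eta.p, eta), eta = xi h. This change is injective because h
    is invertible, so definiteness persists with the opposite sign. *)
Lemma elliptic_point F a :
  a.2 + 1%:M \in unitmx -> (a.2 + 1%:M)^T = a.2 + 1%:M ->
  differentiable F (jet_map a) -> definite (symbol F (jet_map a)) ->
  differentiable (Ftilde F) a /\ definite (symbol (Ftilde F) a).
Proof.
move=> uH sH dF defF.
have FE : Ftilde F = F \o jet_map by apply/funext => b; exact: FtildeE.
have dJ := is_diff_jet_map uH.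
have [dFt dFtE] := is_diff_comp dJ (differentiableP dF).
rewrite FE; split; first exact: dFt.
set h := invmx (a.2 + 1%:M) in dJ dFtE.
have hT : h^T = h by rewrite /h trmx_inv sH.
have uh : h \in unitmx by rewrite unitmx_inv.
have sE tau xi : symbol (F \o jet_map) a tau xi =
    - symbol F (jet_map a) (tau - dot (xi *m h) a.1.2) (xi *m h).
  rewrite (symbolE _ _ dFt) (symbolE _ _ dF).
  apply: etrans (congr1 (fun f => f (tau ^+ 2, tau *: xi, xi^T *m xi)) dFtE) _.
  rewrite -[RHS]linearN.
  congr ('d F (jet_map a) _).
  exact: (jet_map_symbol a.1.2 tau xi hT).
have nz tau xi : (tau, xi) != 0 -> (tau - dot (xi *m h) a.1.2, xi *m h) != 0.
  apply: contra_neq => -[/eqP t0 x0].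
  have xi0 : xi = 0 by rewrite -(mulmxK uh xi) x0 mul0mx.
  by move: t0; rewrite xi0 mul0mx dot0l subr0 => /eqP ->.
by case: defF => defF; [right | left] => tau xi /nz /defF;
  rewrite sE ?oppr_lt0 ?oppr_gt0.
Qed.

End Symbol.

(** * The change of variables: monotonicity and bijectivity *)

Section Transform.
Context {R : realType} {n : nat}.
Local Notation E := ('rV[R]_n * R)%type.
Local Notation dx := (@xdir R n).
Local Notation dt := (tdir R n).
Variable u : E -> R.
Hypothesis u_C2 : C2_torus u.
Hypothesis u_convex : forall p, strip p -> posdef (hess_x u p + 1%:M).
Implicit Types (p q h : E) (x y : 'rV[R]_n) (t : R).

Local Notation G p := (grad_x u p + p.1).
Local Notation M p := (hess_x u p + 1%:M).

Lemma differentiable_C2 p : strip p -> differentiable u p.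
Proof. by case: u_C2 => _ [u1 _] /u1[]. Qed.

Lemma differentiable_derive_C2 v p : strip p -> differentiable ('D_v u) p.
Proof. by case: u_C2 => _ [_ /(_ v) u1] /u1[]. Qed.

Lemma is_diff_legendre p : strip p ->
  is_diff p (fun p => G p) (fun h => h.1 *m M p + h.2 *: grad_t u p).
Proof.
move=> sp.
have g := is_diff_grad_x (fun j => differentiable_derive_C2 (dx j) sp).
apply: (is_diff_eq (is_diffD g (is_diff_fst p))); apply/funext => h.
by rewrite !fctE mulmxDr mulmx1 addrAC.
Qed.

(** Along the segment from x to x', the inner product of G with v = x' - x has as derivative the
    quadratic form of M at v, which is positive. The mean value theorem concludes. *)
Lemma legendre_mono x x' t : strip (x, t) -> x' != x ->
  0 < dot (G (x', t) - G (x, t)) (x' - x).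
Proof.
move=> st xx'; pose v := x' - x.
have v0 : v != 0 by rewrite subr_eq0.
pose g s := dot (G (s *: (v, 0 : R) + (x, t))) v.
have sts s : strip (s *: (v, 0 : R) + (x, t)).
  by move: st; rewrite /strip /= scaler0 add0r.
have gd (s : R) : is_derive s 1 g (dot (v *m M (s *: (v, 0 : R) + (x, t))) v).
  have dG := is_diff_dot (is_diff_legendre (sts s)) (is_diff_cst v _).
  have [dG1 dG2] := dG.
  have := is_derive_line dG1; rewrite (deriveE _ dG1) dG2 /=.
  by rewrite scale0r addr0 dot0r add0r.
have [|c _] := @MVT R g
   (fun s => dot (v *m M (s *: (v, 0 : R) + (x, t))) v) 0 1 ltr01.
  by apply: derivable_within_continuous => s _; have [] := gd s.
have E1 : 1 *: (v, 0 : R) + (x, t) = (x', t).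
  by rewrite scale1r; congr pair; rewrite /= ?add0r // subrK.
rewrite /g scale0r add0r E1 subr0 mulr1 -/v dotBl => ->.
by have [_] := u_convex (sts c); apply.
Qed.

Lemma legendre_inj x x' t : strip (x, t) -> G (x, t) = G (x', t) -> x = x'.
Proof.
move=> st e; apply/eqP; apply: contraT => xx'.
have := legendre_mono st; rewrite eq_sym in xx' => /(_ _ xx').
by rewrite e subrr dot0l ltxx.
Qed.

Lemma is_diff_slice x t : 0 < t < 1 ->
  is_diff x (fun z => u (z, t)) (fun v => dot v (grad_x u (x, t))).
Proof.
move=> t01; have du := @differentiable_C2 (x, t) t01.
have d := is_diff_pair (is_diff_id x) (is_diff_cst t x).
have := is_diff_comp d (differentiableP du).
move=> /is_diff_eq; apply; apply/funext => h.
by rewrite /= diff_coords //= mul0r addr0.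
Qed.

(** Removing integer parts moves any x into the unit cube, which is compact, without changing u. *)
Lemma u_bounded_below t : 0 < t < 1 -> exists m, forall x, m <= u (x, t).
Proof.
move=> t01.
pose Q := [set v : 'rV[R]_n | forall i, `[0, 1]%classic (v ord0 i)].
have Qc : compact Q.
  apply: (@rV_compact R n (fun=> `[0, 1]%classic)) => _.
  exact: segment_compact.
have Q0 : Q !=set0 by exists 0 => i; rewrite mxE /= in_itv /= lexx ler01.
have cu : continuous (fun x => u (x, t)).
  by move=> x; apply: differentiable_continuous; have [] := is_diff_slice x t01.
have [|x0 _ x0min] := EVT_min_rV Q0 Qc (f := fun x => u (x, t)).
  exact: continuous_subspaceT.
exists (u (x0, t)) => x.
pose k : 'rV[int]_n := map_mx Num.floor x.
have [up _] := u_C2.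
have := up k (x - map_mx intr k) t t01; rewrite subrK => ->.
apply: x0min; rewrite inE => i /=; rewrite in_itv /= !mxE.
by have := floor_itv (x ord0 i); rewrite intrD; lra.
Qed.

(** The gradient of [psi] at x is G(x, t) - y, so a minimum point of [psi] is a preimage of y. The
    quadratic term dominates far away, which confines the search to a compact ball. *)
Lemma legendre_surj y t : 0 < t < 1 -> exists x, y = G (x, t).
Proof.
move=> t01; have [m um] := u_bounded_below t01.
pose psi x := u (x, t) + 2^-1 * dot x x - dot x y.
have dpsi x : is_diff x psi (fun v => dot v (G (x, t) - y)).
  have d2 := is_diff_slice x t01.
  have d3 := is_diff_dot (is_diff_id x) (is_diff_id x).
  have d4 := is_diff_dot (is_diff_id x) (is_diff_cst y x).
  have := is_diffB (is_diffD d2 (is_diffZ 2^-1 d3)) d4.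
  move=> /is_diff_eq; apply; apply/funext => h.
  rewrite !fctE /= dot0r add0r dotBr dotDr [dot x h]dotC.
  rewrite -[2^-1 *: _]/(2^-1 * _); lra.
(* If X = |x| >= r, then X^2 / 2 - n |y| X >= X (u(0, t) - m + 1) > u(0, t) - m, because X > 1;
   hence psi(x) exceeds psi(0) = u(0, t). *)
pose r := 2 * (n%:R * `|y|) + 2 * (u (0, t) - m) + 2.
have r2 : 2 <= r.
  by rewrite /r; have := um 0; have := mulr_ge0 (ler0n R n) (normr_ge0 y); lra.
have far x : r <= `|x| -> psi 0 < psi x.
  move=> rx; rewrite /psi.
  rewrite !dot0l mulr0 addr0 subr0.
  have := um x; have := um 0; have := dot_le x y; have := norm_le_dot x.
  have := ler_norm (dot x y).
  set X := `|x| in rx *; set Y := n%:R * `|y| in r r2 rx *.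
  rewrite mulrCA -/Y => h1 h2 h3 h4 h5.
  have : X * (2 * Y + 2 * (u (0, t) - m) + 2) <= X * X.
    by rewrite ler_wpM2l // -/r; lra.
  nra.
pose B := [set x : 'rV[R]_n | `|x| <= r].
have Bc : compact B.
  apply: bounded_closed_compact.
    exists r; split; first exact: num_real.
    by move=> N rN x /= xr; apply: le_trans xr (ltW rN).
  apply: (@closed_comp _ _ (fun v : 'rV[R]_n => `|v|) [set z | z <= r]).
    by move=> v _; exact: norm_continuous.
  exact: closed_le.
have B0 : B !=set0 by exists 0; rewrite /B /= normr0; lra.
have [|x0 _ x0min] := EVT_min_rV B0 Bc (f := psi).
  apply: continuous_subspaceT => x.
  by apply: differentiable_continuous; have [] := dpsi x.
have xmin x : psi x0 <= psi x.
  have [xr|/ltW xr] := leP `|x| r; first by apply: x0min; rewrite inE.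
  apply: le_trans (ltW (far _ xr)); apply: x0min.
  by rewrite inE /B /= normr0; lra.
exists x0; apply/esym/eqP; rewrite -subr_eq0; apply/eqP/rowP => j.
rewrite [RHS]mxE -dot_delta dotC.
(* The minimum is global, hence also a minimum along each coordinate line through x0, and the
   derivative there vanishes; the interval (-1, 1) is an arbitrary choice. *)
pose g s := psi (s *: delta_mx 0 j + x0).
have gd (s : R) : is_derive s 1 g
    ('D_(delta_mx 0 j) psi (s *: delta_mx 0 j + x0)).
  by apply: is_derive_line; have [] := dpsi (s *: delta_mx 0 j + x0).
have g0 : is_derive (0 : R) 1 g 0.
  apply: (@derive1_at_min R g (-1) 1 0); rewrite ?in_itv /=; try lra.
    by move=> s _; have [] := gd s.
  by move=> s _; rewrite /g scale0r add0r.
have [_ <-] := g0; have [_ ->] := gd 0.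
have [d1 d2] := dpsi (0 *: delta_mx 0 j + x0).
by rewrite deriveE // d2 scale0r add0r.
Qed.

(** * The inverse x(y, s) and its differentiability *)

Lemma xcoordP q : strip q -> q.1 = G (xcoord u q, q.2).
Proof.
move=> sq; have [x xE] := legendre_surj q.1 sq.
by apply: (getPex (P := [set x | q.1 = grad_x u (x, q.2) + x])); exists x.
Qed.

Lemma xcoord_change_var p : strip p -> xcoord u (change_var u p) = p.1.
Proof.
case: p => x t st; have sq : strip (change_var u (x, t)) by [].
by apply: (@legendre_inj _ _ t) => //; rewrite -(xcoordP sq).
Qed.

(* If |x - x0| exceeded C |h|, monotonicity along the segment from x0 to x would
   compare y with the value of G at distance exactly C |h| from x0, where the
   differential of G at x0 forces a contradiction for large C.  Continuity
   of the inverse is thus not needed beforehand. *)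
Lemma xcoord_lipschitz q : strip q -> exists2 C, 1 <= C &
  \forall h \near (0 : E), `|xcoord u (h + q) - xcoord u q| <= C * `|h|.
Proof.
move=> sq; set p := (xcoord u q, q.2).
have sp : strip p by [].
have [c c0 cM] := posdef_coercive (u_convex sp).
have [dG dGE] := is_diff_legendre sp.
set b := grad_t u p in dGE.
(* K |h| bounds the terms in h.1 and h.2 of the final inequality. C is such that C c / 2 = K + c /
   2, and e such that n e <= c / 2: half of the coercivity term absorbs the linearization error of G
   and the other half beats K |h|. The n + 1 in e avoids a zero denominator when n = 0. *)
pose K := n%:R * (1 + `|b|).
have K0 : 0 <= K by rewrite mulr_ge0 // addr_ge0.
pose C := 2 * K / c + 1.
have C1 : 1 <= C by rewrite lerDr divr_ge0 ?mulr_ge0 // ltW.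
have C0 : 0 < C by lra.
pose e := c / (2 * (n%:R + 1)).
have e0 : 0 < e by rewrite divr_gt0 // mulr_gt0 // ltr_wpDl.
exists C => //.
have /nbhs_normP[r /= r0 rP] := differentiable_near0 dG e0.
have n1 : \forall h \near (0 : E), strip (h + q).
  by have := near_strip sq; rewrite (near_shift 0 q) subr0.
have n2 : \forall h \near (0 : E), `|h| < r / C.
  apply/nbhs_normP; exists (r / C); first by rewrite /= divr_gt0.
  by move=> h /=; rewrite sub0r normrN.
near=> h.
have sh : strip (h + q) by near: h.
have hr : `|h| < r / C by near: h.
rewrite leNgt; apply/negP.
set d := `|h| in hr *; set z := xcoord u (h + q) - xcoord u q => dz.
have d0 : 0 <= d := normr_ge0 h.
have z0 : 0 < `|z| by apply: le_lt_trans dz; rewrite mulr_ge0 // ltW.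
pose v := `|z|^-1 *: z.
have v1 : `|v| = 1 by rewrite normrZ normfV normr_id mulVf // gt_eqF.
(* Then k + p has the time of h + q, and its space component lies on the segment from x(q) to x(h +
   q), at distance C d from x(q). *)
pose k : E := (C * d *: v, h.2).
have kd : `|k| <= C * d.
  rewrite prod_normE /= ge_max normrZ v1 mulr1 ger0_norm ?mulr_ge0 ?(ltW C0) //.
  rewrite lexx /=.
  apply: le_trans (_ : d <= _); first by rewrite /d prod_normE le_max lexx orbT.
  by rewrite ler_peMl.
have kr : `|k| < r by apply: le_lt_trans kd _; rewrite mulrC -ltr_pdivlMr.
have := rP k; rewrite /= sub0r normrN => /(_ kr).
rewrite dGE /= => err.
have kp : k + p = (C * d *: v + xcoord u q, (h + q).2) by [].
have zE : xcoord u (h + q) - (C * d *: v + xcoord u q) = (`|z| - C * d) *: v.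
  have zv : `|z| *: v = z by rewrite /v scalerA divff ?gt_eqF // scale1r.
  rewrite scalerBl zv /z.
  by rewrite opprD addrA addrAC.
have := @legendre_mono
  (C * d *: v + xcoord u q) (xcoord u (h + q)) (h + q).2 sh.
rewrite zE dotZr -kp -(xcoordP sh) -subr_eq0 zE => /(_ _)/wrap[].
  rewrite scaler_eq0 negb_or subr_eq0 gt_eqF //= -normr_eq0 v1 oner_eq0 //.
rewrite pmulr_rgt0 ?subr_gt0 //.
(* w is the linearization error of G at p, of norm at most e C d. *)
set w := G (k + p) - G p - (C * d *: v *m M p + h.2 *: b) in err.
have -> : (h + q).1 - G (k + p) = h.1 - w - (C * d) *: (v *m M p) - h.2 *: b.
  have -> : (h + q).1 = h.1 + G p by rewrite -(xcoordP sq).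
  rewrite /w -scalemxAl.
  move: (G (k + p)) (G p) (C * d *: _) (h.2 *: b) => g1 g2 g3 g4.
  by apply/rowP => j; rewrite !mxE; ring.
clearbody w; rewrite !dotBl !dotZl.
have := cM v; rewrite v1 !mulr1 => cv.
have := dot_le h.1 v; have := dot_le w v; have := dot_le b v; rewrite v1 !mulr1.
move=> /ler_normlP[bv bv'] /ler_normlP[wv _] /ler_normlP[_ hv].
have h1d : `|h.1| <= d by rewrite /d prod_normE le_max lexx.
have h2d : `|h.2| <= d by rewrite /d prod_normE le_max lexx orbT.
have n0 : 0 <= n%:R :> R by [].
have t1 : dot h.1 v <= n%:R * d by apply: le_trans hv _; rewrite ler_wpM2l.
have t2 : - dot w v <= n%:R * (e * (C * d)).
  apply: le_trans wv _; rewrite ler_wpM2l //; apply: le_trans err _.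
  by rewrite ler_wpM2l // ltW.
have t3 : - (h.2 * dot b v) <= d * (n%:R * `|b|).
  apply: le_trans (ler_norm _) _; rewrite normrN normrM.
  by apply: ler_pM => //; rewrite ler_norml bv' andbT lerNl.
have t4 : C * d * c <= C * d * dot (v *m M p) v.
  by rewrite ler_wpM2l // mulr_ge0 // ltW.
have ne : n%:R * e <= c / 2.
  rewrite /e mulrA ler_pdivrMr; last lra.
  nra.
have Cc : C * (c / 2) = K + c / 2.
  by rewrite /C; field; rewrite gt_eqF.
have t5 : n%:R * (e * (C * d)) <= c / 2 * (C * d).
  by rewrite mulrA ler_wpM2r // mulr_ge0 // ltW.
have t6 : c / 2 * (C * d) = d * (K + c / 2) by rewrite -Cc; ring.
have t7 : d * K = n%:R * d + d * (n%:R * `|b|) by rewrite /K; ring.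
have t8 : C * d * c = 2 * (d * (K + c / 2)) by rewrite -Cc; field.
have t9 : 0 <= d * c by rewrite mulr_ge0 // ltW.
by move: t6 t8; rewrite mulrDr; lra.
Unshelve. all: end_near. Qed.

(** The solution v of h.1 = v M + h.2 b. The index p is the point (x, t) where M and b are taken,
    while h is a direction in (y, s). *)
Definition diff_xcoord p h : 'rV[R]_n :=
  (h.1 - h.2 *: grad_t u p) *m invmx (hess_x u p + 1%:M).

Lemma is_diff_diff_xcoord p h : is_diff h (diff_xcoord p) (diff_xcoord p).
Proof.
have d1 : is_diff h (fun k : E => k.2 *: grad_t u p)
    (fun k => k.2 *: grad_t u p).
  have [s1 s2] := is_diff_snd h.
  by apply: DiffDef; [exact: differentiableZl | rewrite diffZl // s2].
have := is_diff_mulmx (is_diffB (is_diff_fst h) d1)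
  (is_diff_cst (invmx (M p)) h).
by move=> /is_diff_eq; apply; apply/funext => k; rewrite mulmx0 add0r.
Qed.

(** Linearize G at p along the actual displacement of x. The remainder is small relative to that
    displacement, hence relative to h by the Lipschitz bound, and multiplying by M^-1 isolates the
    displacement. *)
Lemma is_diff_xcoord q : strip q ->
  is_diff q (xcoord u) (diff_xcoord (xcoord u q, q.2)).
Proof.
move=> sq; set p := (xcoord u q, q.2).
have sp : strip p by [].
have [C C1 lipC] := xcoord_lipschitz sq.
have [dF1 dF2] := is_diff_diff_xcoord p 0.
have uM := posdef_unitmx (u_convex sp).
set N := invmx (M p).
have [K K0 KN] : exists2 K, 0 < K & forall w : 'rV[R]_n, `|w *m N| <= K * `|w|.
  apply: (linear_lipschitz (f := mulmxr N)) => w.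
  apply: differentiable_continuous.
  by have [] := is_diff_mulmx (is_diff_id w) (is_diff_cst N w).
have [dG dGE] := is_diff_legendre sp.
(* [diff_xcoord p] is its own differential at 0; writing it as such supplies the linear structure
   that [is_diff_near0] asks for. *)
rewrite -dF2; apply: is_diff_near0; first exact: diff_continuous.
move=> e e0; rewrite dF2.
have C0 : 0 < C by lra.
(* K bounds multiplication by M^-1 and C is the Lipschitz constant of x; the remainder is multiplied
   by both. *)
have e'0 : 0 < e / (K * C) by rewrite divr_gt0 // mulr_gt0.
have /nbhs_normP[r /= r0 rP] := differentiable_near0 dG e'0.
have n1 : \forall h \near (0 : E), strip (h + q).
  by have := near_strip sq; rewrite (near_shift 0 q) subr0.
have n2 : \forall h \near (0 : E), `|h| < r / C.
  apply/nbhs_normP; exists (r / C); first by rewrite /= divr_gt0.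
  by move=> h /=; rewrite sub0r normrN.
near=> h.
have sh : strip (h + q) by near: h.
have hr : `|h| < r / C by near: h.
have : `|xcoord u (h + q) - xcoord u q| <= C * `|h| by near: h.
set z := xcoord u (h + q) - xcoord u q => zC.
pose k : E := (z, h.2).
have kC : `|k| <= C * `|h|.
  rewrite prod_normE /= ge_max zC /=.
  apply: le_trans (_ : `|h| <= _); first by rewrite prod_normE le_max lexx orbT.
  by rewrite ler_peMl.
have kr : `|k| < r by apply: le_lt_trans kC _; rewrite mulrC -ltr_pdivlMr.
have kp : k + p = (xcoord u (h + q), (h + q).2) by congr pair; exact: subrK.
have err : `|(h + q).1 - q.1 - (z *m M p + h.2 *: grad_t u p)|
    <= e / (K * C) * `|k|.
  rewrite (xcoordP sh) (xcoordP sq) -kp.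
  by have := rP k; rewrite /= sub0r normrN dGE => /(_ kr).
have -> : z - diff_xcoord p h =
    - ((h + q).1 - q.1 - (z *m M p + h.2 *: grad_t u p)) *m N.
  rewrite /diff_xcoord -/N /= addrK -[X in X - _](mulmxK uM) -/N -mulmxBl.
  congr (_ *m _); move: (z *m M p) (h.2 *: _) h.1 => a b c.
  by rewrite !opprB addrA.
apply: le_trans (KN _) _; rewrite normrN.
apply: le_trans (ler_wpM2l (ltW K0) err) _.
apply: le_trans (ler_wpM2l (ltW K0) (ler_wpM2l (ltW e'0) kC)) _.
have Kd (d : R) : K * (e / (K * C) * (C * d)) = e * d.
  by field; rewrite !gt_eqF.
by rewrite Kd.
Unshelve. all: end_near. Qed.

(** * First and second derivatives of the partial Legendre transform *)

Lemma plegendreE :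
  plegendre u = fun q => - (2^-1 * dot (xcoord u q - q.1) (xcoord u q - q.1))
    - u (xcoord u q, q.2).
Proof.
apply/funext => q; rewrite /plegendre; congr (- (_ * _) - _).
by rewrite dotE; apply: eq_bigr => j _; rewrite !mxE expr2.
Qed.

Lemma is_diff_comp_xcoord (g : E -> R) q : strip q ->
  differentiable g (xcoord u q, q.2) ->
  is_diff q (fun q => g (xcoord u q, q.2)) (fun h =>
    dot (diff_xcoord (xcoord u q, q.2) h) (grad_x g (xcoord u q, q.2))
    + h.2 * 'D_dt g (xcoord u q, q.2)).
Proof.
move=> sq dg; have d1 := is_diff_pair (is_diff_xcoord sq) (is_diff_snd q).
have := is_diff_comp d1 (differentiableP dg).
by move=> /is_diff_eq; apply; apply/funext => h; rewrite /= diff_coords.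
Qed.

(** At x = x(y, s) the gradient of u is y - x, so the contributions of the differential of x from
    the square and from u cancel. *)
Lemma is_diff_plegendre q : strip q ->
  is_diff q (plegendre u) (fun h =>
    dot (xcoord u q - q.1) h.1 - h.2 * 'D_dt u (xcoord u q, q.2)).
Proof.
move=> sq; rewrite plegendreE.
have sp : strip (xcoord u q, q.2) by [].
have d1 := is_diffB (is_diff_xcoord sq) (is_diff_fst q).
have d2 := is_diff_dot d1 d1.
have d3 := is_diff_comp_xcoord sq (differentiable_C2 sp).
have := is_diffB (is_diffN (is_diffZ 2^-1 d2)) d3.
move=> /is_diff_eq; apply; apply/funext => h; rewrite !fctE.
have -> : grad_x u (xcoord u q, q.2) = - (xcoord u q - q.1).
  by rewrite [in RHS](xcoordP sq) opprB addrK.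
rewrite -[_ *: (_ + _)]/(_ * (_ + _)) [dot (_ - _) (xcoord u q - _)]dotC.
rewrite dotNr [dot (diff_xcoord _ _) _]dotC dotBr; lra.
Qed.

Lemma derive_plegendre v q : strip q ->
  'D_v (plegendre u) q =
    dot (xcoord u q - q.1) v.1 - v.2 * 'D_dt u (xcoord u q, q.2).
Proof.
by move=> sq; have [d1 d2] := is_diff_plegendre sq; rewrite deriveE // d2.
Qed.

(** The first derivatives of f involve only x(y, s), y and u_t, all differentiable, and the formula
    for them holds on a neighbourhood of q. Thus f can be differentiated twice although x(y, s) is
    built from first derivatives of u. *)
Lemma is_diff_derive_plegendre v q : strip q ->
  is_diff q ('D_v (plegendre u)) (fun h =>
    dot (diff_xcoord (xcoord u q, q.2) h - h.1) v.1
    - v.2 * (dot (diff_xcoord (xcoord u q, q.2) h)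
               (grad_x ('D_dt u) (xcoord u q, q.2))
             + h.2 * d2t u (xcoord u q, q.2))).
Proof.
move=> sq; have sp : strip (xcoord u q, q.2) by [].
apply: (near_is_diff (f := fun q =>
  dot (xcoord u q - q.1) v.1 - v.2 * 'D_dt u (xcoord u q, q.2))).
  by apply: filterS (near_strip sq) => y sy; rewrite derive_plegendre.
have d1 := is_diffB (is_diff_xcoord sq) (is_diff_fst q).
have d2 := is_diff_dot d1 (is_diff_cst v.1 q).
have d3 := is_diff_comp_xcoord sq (differentiable_derive_C2 dt sp).
have := is_diffB d2 (is_diffZ v.2 d3).
by move=> /is_diff_eq; apply; apply/funext => h; rewrite !fctE dot0r add0r.
Qed.

Lemma derive2_plegendre v w q : strip q ->
  'D_w ('D_v (plegendre u)) q =
    dot (diff_xcoord (xcoord u q, q.2) w - w.1) v.1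
    - v.2 * (dot (diff_xcoord (xcoord u q, q.2) w)
               (grad_x ('D_dt u) (xcoord u q, q.2))
             + w.2 * d2t u (xcoord u q, q.2)).
Proof.
move=> sq; have [d1 d2] := is_diff_derive_plegendre v sq.
by rewrite deriveE // d2.
Qed.

Lemma grad_tE p : strip p -> grad_t u p = grad_x ('D_dt u) p.
Proof.
move=> sp; apply/rowP => j; rewrite /grad_t /grad_x [LHS]mxE [RHS]mxE.
have du : \forall y \near p, differentiable u y.
  by apply: filterS (near_strip sp); exact: differentiable_C2.
have d1 := differentiable_derive_C2 (dx j) sp.
have d2 := differentiable_derive_C2 dt sp.
exact: (derive_comm du d1 d2).
Qed.

Lemma diff_xcoord_dx p j :
  diff_xcoord p (dx j) = delta_mx 0 j *m invmx (M p).
Proof. by rewrite /diff_xcoord /= scale0r subr0. Qed.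

Lemma diff_xcoord_dt p : diff_xcoord p dt = - (grad_t u p *m invmx (M p)).
Proof. by rewrite /diff_xcoord /= scale1r sub0r mulNmx. Qed.

Lemma hess_x_plegendre q : strip q ->
  hess_x (plegendre u) q = invmx (M (xcoord u q, q.2)) - 1%:M.
Proof.
move=> sq; apply/matrixP => j k; rewrite mxE derive2_plegendre //.
rewrite diff_xcoord_dx -rowE /= mul0r subr0 dot_delta !mxE eqxx /=.
by rewrite [k == j]eq_sym.
Qed.

Lemma d2t_plegendre q : strip q -> let p := (xcoord u q, q.2) in
  d2t (plegendre u) q =
    dot (grad_t u p *m invmx (M p)) (grad_t u p) - d2t u p.
Proof.
move=> sq p; rewrite /d2t derive2_plegendre // diff_xcoord_dt -grad_tE //=.
by rewrite dot0r mul1r mul1r dotNl sub0r opprD opprK.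
Qed.

Lemma mixed_plegendre q : strip q -> let p := (xcoord u q, q.2) in
  \row_j 'D_(dx j) ('D_dt (plegendre u)) q = - (grad_t u p *m invmx (M p)).
Proof.
move=> sq p; have [Msym _] := u_convex (sq : strip p).
apply/rowP => j; rewrite !mxE derive2_plegendre // diff_xcoord_dx -grad_tE //=.
rewrite dot0r mul0r mul1r addr0 sub0r dot_mulmx dotC trmx_inv Msym.
by rewrite dot_delta mxE.
Qed.

Lemma jet2_plegendre q : strip q -> let p := (xcoord u q, q.2) in
  jet2 (plegendre u) q =
    (dot (grad_t u p *m invmx (M p)) (grad_t u p) - d2t u p,
     - (grad_t u p *m invmx (M p)), invmx (M p) - 1%:M).
Proof.
move=> sq p; rewrite /jet2 d2t_plegendre // mixed_plegendre //.
by rewrite hess_x_plegendre.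
Qed.

Lemma jet2E p : strip p -> jet2 u p = (d2t u p, grad_t u p, hess_x u p).
Proof. by move=> sp; rewrite /jet2 grad_tE. Qed.

(** * Periodicity and C^2 regularity of the transform *)

Lemma periodic_derive v k x t : strip (x, t) ->
  'D_v u (x + map_mx intr k, t) = 'D_v u (x, t).
Proof.
move=> st; have [uper _] := u_C2.
pose s := (map_mx intr k : 'rV[R]_n, 0 : R).
have -> : (x + map_mx intr k, t) = (x, t) + s by congr pair; rewrite /= addr0.
(* Periodicity holds on the strip, which is a neighbourhood of the point, and this determines the
   derivative. *)
have <- : 'D_v (fun p => u (p + s)) (x, t) = 'D_v u (x, t).
  apply: near_eq_derive; apply: filterS (near_strip st) => -[y r] sy.
  by rewrite -(uper k) //; congr (u (_, _)); rewrite /= addr0.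
rewrite /derive; have -> // : u \o shift ((x, t) + s) =
    (fun p => u (p + s)) \o shift (x, t).
by apply/funext => p; rewrite /= addrA.
Qed.

(** Since grad_x u is periodic, x(y, s) + k solves the equation for y + k, so by injectivity x(y +
    k, s) = x(y, s) + k. Then x - y and u(x, s) are unchanged. *)
Lemma periodic_plegendre : periodic (plegendre u).
Proof.
move=> k y t st.
have xE : xcoord u (y + map_mx intr k, t) = xcoord u (y, t) + map_mx intr k.
  apply: (@legendre_inj _ _ t) => //.
  rewrite -[LHS](xcoordP (q := (y + map_mx intr k, t))) //=.
  rewrite addrA (_ : grad_x u _ = grad_x u (xcoord u (y, t), t)).
    by congr (_ + _); exact: (xcoordP (q := (y, t)) st).
  by apply/rowP => j; rewrite /grad_x [LHS]mxE [RHS]mxE; exact: periodic_derive.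
have [uper _] := u_C2.
rewrite !plegendreE /= xE uper //.
by rewrite opprD addrACA subrr addr0.
Qed.

Lemma continuous_C2 v w p : strip p -> {for p, continuous ('D_w ('D_v u))}.
Proof. by case: u_C2 => _ [_ /(_ v) u1] /u1[_ /(_ w)]. Qed.

(** The first derivatives are differentiable, hence continuous. The second derivatives are
    continuous by their explicit formula, in which continuous second derivatives of u are composed
    with the continuous map (y, s) |-> (x, s). *)
Lemma C2_plegendre : C2_torus (plegendre u).
Proof.
split; first exact: periodic_plegendre.
split=> [q sq|v q sq]; split.
- by have [] := is_diff_plegendre sq.
- move=> v; apply: differentiable_continuous.
  by have [] := is_diff_derive_plegendre v sq.
- by have [] := is_diff_derive_plegendre v sq.
move=> w.
have sp : strip (xcoord u q, q.2) by [].
have cP : {for q, continuous (fun q => (xcoord u q, q.2))}.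
  apply: differentiable_continuous.
  by have [] := is_diff_pair (is_diff_xcoord sq) (is_diff_snd q).
have cD v1 v2 : {for q, continuous
    (fun q => 'D_v1 ('D_v2 u) (xcoord u q, q.2))}.
  exact: (continuous_comp cP (continuous_C2 (v := v2) (w := v1) sp)).
have cb : {for q, continuous (fun q => grad_t u (xcoord u q, q.2))}.
  apply: continuous_entries => i j; apply: near_continuous (cD dt (dx j)).
  by near=> y; rewrite /grad_t mxE.
have ca : {for q, continuous (fun q => grad_x ('D_dt u) (xcoord u q, q.2))}.
  apply: continuous_entries => i j; apply: near_continuous (cD (dx j) dt).
  by near=> y; rewrite /grad_x mxE.
have cM : {for q, continuous (fun q => M (xcoord u q, q.2))}.
  apply: continuous_entries => i j.
  apply: near_continuous (continuousD (cD (dx i) (dx j))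
    (cvg_cst ((1%:M : 'M[R]_n) i j))).
  by near=> y; rewrite [RHS]mxE /hess_x [in RHS]mxE.
have cN : {for q, continuous (fun q => invmx (M (xcoord u q, q.2)))}.
  exact: (continuous_comp cM (continuous_invmx (posdef_unitmx (u_convex sp)))).
have cX : {for q, continuous (fun q => diff_xcoord (xcoord u q, q.2) w)}.
  apply: continuous_mulmx cN.
  have c0 := continuousB (@cst_continuous _ _ w.1 q)
    (continuousZl_tmp (k := w.2) cb).
  exact: c0.
have cw : {for q, continuous (fun q => diff_xcoord (xcoord u q, q.2) w - w.1)}.
  by apply: continuousB; [exact: cX | exact: cvg_cst].
have c1 := continuous_dot cw (@cst_continuous _ _ v.1 q).
have c2 := continuousD (continuous_dot cX ca)
  (continuousZl_tmp (k := w.2) (cD dt dt)).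
apply: near_continuous (continuousB c1 (continuousZl_tmp (k := v.2) c2)).
by apply: filterS (near_strip sq) => y sy; rewrite derive2_plegendre.
Unshelve. all: end_near. Qed.

(** The second factor is the Schur complement of the block M: a column operation of determinant 1
    clears the upper right block. *)
Lemma det_hess_xt p : strip p ->
  \det (hess_xt u p + I_x) =
    \det (M p) * (d2t u p - dot (grad_t u p *m invmx (M p)) (grad_t u p)).
Proof.
move=> sp; have uM := posdef_unitmx (u_convex sp).
set b := grad_t u p; set N := invmx (M p).
have -> : hess_xt u p + I_x = block_mx (M p) (b^T) b (d2t u p)%:M.
  rewrite -[hess_xt u p]submxK /I_x add_block_mx !addr0.
  congr block_mx; apply/matrixP => i j.
  - by rewrite !mxE /xtdir !(unsplitK (inl _)).
  - rewrite /b grad_tE // !mxE /xtdir (unsplitK (inl _)) (unsplitK (inr _)).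
    by [].
  - rewrite /b /grad_t !mxE /xtdir (unsplitK (inl _)) (unsplitK (inr _)).
    by [].
  - by rewrite !mxE /xtdir !(unsplitK (inr _)) !ord1 eqxx mulr1n.
have e : block_mx (M p) b^T b (d2t u p)%:M
      *m block_mx 1%:M (- (N *m b^T)) 0 1%:M
    = block_mx (M p) 0 b (d2t u p - dot (b *m N) b)%:M.
  rewrite mulmx_block !mulmx1 !mulmx0 !addr0 !mulmxN mulmxA mulmxV // mul1mx.
  rewrite addNr; congr (block_mx _ _ _ _).
  by rewrite addrC raddfB /= mulmxA [in RHS]/dot -mx11_scalar.
have := congr1 determinant e.
by rewrite det_mulmx det_ublock det_lblock !det1 !mulr1 det_scalar1.
Qed.

Lemma monge_ampere_plegendre q : strip q ->
  \det (hess_xt u (xcoord u q, q.2) + I_x) =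
    - d2t (plegendre u) q * \det (M (xcoord u q, q.2)).
Proof.
move=> sq; rewrite det_hess_xt // d2t_plegendre //.
by rewrite opprB mulrC.
Qed.

End Transform.

Theorem theorem1 (R : realType) (n : nat) (u : 'rV[R]_n * R -> R)
    (u_C2 : C2_torus u)
    (u_convex : forall p, strip p -> posdef (hess_x u p + 1%:M)) :
  [/\ C2_torus (plegendre u) /\
      (forall q, strip q -> posdef (hess_x (plegendre u) q + 1%:M)),
      forall (Omega : set (R * 'rV[R]_n * 'M[R]_n))
             (F : R * 'rV[R]_n * 'M[R]_n -> R),
        open Omega -> C1_on Omega F ->
        (forall p, strip p -> Omega (jet2 u p)) ->
        elliptic F u ->
        [/\ forall p, strip p ->
              F (jet2 u p) = Ftilde F (jet2 (plegendre u) (change_var u p)),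
            (forall p, strip p -> F (jet2 u p) = 0) <->
            (forall q, strip q -> Ftilde F (jet2 (plegendre u) q) = 0)
          & elliptic (Ftilde F) (plegendre u)]
    & forall K : 'rV[R]_n * R -> R,
        (forall p, strip p -> \det (hess_xt u p + I_x) = K p) <->
        (forall q, strip q ->
           d2t (plegendre u) q
           + K (xcoord u q, q.2) * \det (hess_x (plegendre u) q + 1%:M) = 0)].
Proof.
have hess1 q : strip q -> hess_x (plegendre u) q + 1%:M =
    invmx (hess_x u (xcoord u q, q.2) + 1%:M).
  by move=> sq; rewrite (hess_x_plegendre u_C2 u_convex sq) subrK.
have pos1 q : strip q -> posdef (hess_x (plegendre u) q + 1%:M).
  by move=> sq; rewrite (hess1 q sq); apply/posdef_invmx/u_convex.
(* Every point of the strip is (x(q), q.2) for some q in the strip, so a statement at all such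
   points is a statement on the whole strip. *)
have change_varK p : strip p ->
    (xcoord u (change_var u p), (change_var u p).2) = p.
  move=> sp.
  by rewrite (xcoord_change_var u_C2 u_convex sp) -surjective_pairing.
(* [jet_map] undoes the formulas for the second derivatives of f: inverting M^-1 returns M, then b
   M^-1 M = b, and the two quadratic terms in b cancel. *)
have jetK q : strip q ->
    jet_map (jet2 (plegendre u) q) = jet2 u (xcoord u q, q.2).
  move=> sq; have sp : strip (xcoord u q, q.2) by [].
  have [symM _] := u_convex _ sp.
  have uM := posdef_unitmx (u_convex _ sp).
  rewrite (jet2E u_C2 sp) (jet2_plegendre u_C2 u_convex sq) /jet_map /=.
  rewrite subrK invmxK mulNmx mulmxKV // opprK addrK.
  by rewrite dotNl dotNr opprK [dot (grad_t _ _) _]dotC opprB subrK.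
split; first by split; [exact: C2_plegendre | exact: pos1].
  move=> Omega F _ _ _ ellF.
  have FE q : strip q ->
      Ftilde F (jet2 (plegendre u) q) = F (jet2 u (xcoord u q, q.2)).
    by move=> sq; rewrite FtildeE jetK.
  split.
  - by move=> p sp; rewrite (FE (change_var u p) sp) (change_varK p sp).
  - split=> [F0 q sq|F0 p sp].
      exact: etrans (FE q sq) (F0 (xcoord u q, q.2) sq).
    by rewrite -(change_varK p sp) -(FE (change_var u p) sp)
      (F0 (change_var u p) sp).
  - move=> q sq; have [dF defF] := ellF (xcoord u q, q.2) sq.
    have [sym1 _] := pos1 q sq.
    by apply: elliptic_point; rewrite ?jetK //; exact/posdef_unitmx/pos1.
move=> K.
(* Pointwise, det(D_y^2 f + I) = 1 / det M, and the Monge-Ampere determinant is - f_ss det M; the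
   two equations differ by the nonzero factor det M. *)
have key q : strip q -> (\det (hess_xt u (xcoord u q, q.2) + I_x) =
    K (xcoord u q, q.2)) <-> (d2t (plegendre u) q
    + K (xcoord u q, q.2) * \det (hess_x (plegendre u) q + 1%:M) = 0).
  move=> sq; have -> := etrans (congr1 determinant (hess1 q sq)) (det_inv _).
  rewrite (monge_ampere_plegendre u_C2 u_convex sq).
  have := posdef_unitmx (u_convex (xcoord u q, q.2) sq).
  rewrite unitmxE unitfE; set D := \det _ => D0.
  split=> [<-|/eqP]; first by rewrite (mulfK D0) subrr.
  by rewrite addr_eq0 => /eqP ->; rewrite opprK (mulfVK D0).
split=> [H q sq|H p sp]; first exact: ((key q sq).1 (H (xcoord u q, q.2) sq)).
rewrite -(change_varK p sp).
exact: ((key (change_var u p) sp).2 (H (change_var u p) sp)).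
Qed.
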